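(* Let $\epsilon_1,\epsilon_2\ge 0$ and let $f(t,\mathbf{x},\mathbf{c})$ be a solution of the mean-field equation $$\partial_t f(t,\mathbf{x},\mathbf{c})+\nabla_{\mathbf{x}}\cdot\big(\mathbf{V}_{\epsilon_1,\epsilon_2}(t,\mathbf{x},\mathbf{c})\,f(t,\mathbf{x},\mathbf{c})\big)=0$$ with symmetric kernel $\mathcal{A}_{\epsilon_1,\epsilon_2}$, i.e. with $\sigma(t,\mathbf{x},\mathbf{c})=1$. Then, for each $k,j=1,\dots,d_1$ and all $t\ge 0$, $$\frac{\mathrm{d}}{\mathrm{d}t}u_k(t)=0,\qquad \frac{\mathrm{d}}{\mathrm{d}t}E_{kk}(t)\le 0,\qquad |E_{kj}(t)|\le \tfrac12\big(E_{kk}(0)+E_{jj}(0)\big).$$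
   Context: Let $\Omega_1\subseteq\mathbb{R}^{d_1}$ and $\Omega_2\subseteq\mathbb{R}^{d_2}$ be compact domains, $\Omega=\Omega_1\times\Omega_2$, and fix norms $\|\cdot\|$ on $\mathbb{R}^{d_1}$ and $\mathbb{R}^{d_2}$. For $\epsilon\ge0$ let $\chi_\epsilon(r)=1$ if $r\le\epsilon$ and $\chi_\epsilon(r)=0$ otherwise. The kernel and velocity field are $$\mathcal{A}_{\epsilon_1,\epsilon_2}(t,\mathbf{x},\mathbf{c},\mathbf{y},\mathbf{z})=\frac{\chi_{\epsilon_1}(\|\mathbf{y}-\mathbf{x}\|)\,\chi_{\epsilon_2}(\|\mathbf{z}-\mathbf{c}\|)}{\sigma(t,\mathbf{x},\mathbf{c})},\qquad \mathbf{V}_{\epsilon_1,\epsilon_2}(t,\mathbf{x},\mathbf{c})=\int_\Omega \mathcal{A}_{\epsilon_1,\epsilon_2}(t,\mathbf{x},\mathbf{c},\mathbf{y},\mathbf{z})\,(\mathbf{y}-\mathbf{x})\,f(t,\mathbf{y},\mathbf{z})\,\mathrm{d}\mathbf{z}\,\mathrm{d}\mathbf{y}.$$ In the symmetric case $\sigma\equiv1$. A solution $f$ is a family $f(t,\cdot,\cdot)$, $t\ge0$, of probability distributions on $\Omega$ satisfying the equation in weak form: for all test functions $\varphi\in C^1_0(\Omega)$ (continuous, compactly supported functions on the compact set $\Omega$ with continuous derivative, so that in particular restrictions to $\Omega$ of polynomials are admissible), $$\frac{\mathrm{d}}{\mathrm{d}t}\int_\Omega\varphi\, f(t,\mathbf{x},\mathbf{c})\,\mathrm{d}\mathbf{x}\,\mathrm{d}\mathbf{c}=\int_\Omega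 \mathbf{V}_{\epsilon_1,\epsilon_2}(t,\mathbf{x},\mathbf{c})\cdot\nabla_{\mathbf{x}}\varphi(\mathbf{x},\mathbf{c})\,f(t,\mathbf{x},\mathbf{c})\,\mathrm{d}\mathbf{x}\,\mathrm{d}\mathbf{c},\qquad t\ge 0.$$ (Densities may be measures; $f\,\mathrm{d}\mathbf{x}\,\mathrm{d}\mathbf{c}$ denotes integration against them.) Moments: $u_k(t)=\int_\Omega x_k\,f(t,\mathbf{x},\mathbf{c})\,\mathrm{d}\mathbf{x}\,\mathrm{d}\mathbf{c}$ and $E_{kj}(t)=\int_\Omega x_kx_j\,f(t,\mathbf{x},\mathbf{c})\,\mathrm{d}\mathbf{x}\,\mathrm{d}\mathbf{c}$ for $k,j=1,\dots,d_1$. *)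

(* Defs.v *)
From HB Require Import structures.
From mathcomp Require Import all_boot all_order all_algebra.
From mathcomp Require Import all_classical all_reals all_analysis.

Set Implicit Arguments.
Unset Strict Implicit.
Unset Printing Implicit Defensive.

Import Order.TTheory GRing.Theory Num.Theory.
Import numFieldNormedType.Exports.

Local Open Scope classical_set_scope.
Local Open Scope ring_scope.

(* An arbitrary norm on R^d, independent of the canonical (sup) norm that
   carries the topology of 'rV[R]_d; nonnegativity follows from the axioms. *)
Record is_norm (R : realType) (d : nat) (N : 'rV[R]_d -> R) : Prop := IsNorm {
  is_norm_triangle : forall x y : 'rV[R]_d, N (x + y) <= N x + N y ;
  is_norm_scale : forall (a : R) (x : 'rV[R]_d), N (a *: x) = `|a| * N x ;
  is_norm_definite : forall x : 'rV[R]_d, N x = 0 -> x = 0 }.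

Definition state (R : realType) (d1 d2 : nat) : Type :=
  ('rV[R]_d1 * 'rV[R]_d2)%type.

(* R^d1 x R^d2 with its Borel sigma-algebra. *)
Definition borel_state (R : realType) (d1 d2 : nat) :=
  g_sigma_algebraType (@open ('rV[R]_d1 * 'rV[R]_d2)%type).

Section MeanField.
Variables (R : realType) (d1 d2 : nat).
Variables (N1 : 'rV[R]_d1 -> R) (N2 : 'rV[R]_d2 -> R).
Variables (Omega1 : set 'rV[R]_d1) (Omega2 : set 'rV[R]_d2).
Variables (e1 e2 : R) (sigma : R -> 'rV[R]_d1 -> 'rV[R]_d2 -> R).
(* Only the values f t with 0 <= t are relevant. *)
Variable f : R -> probability (borel_state R d1 d2) R.

Let Omega : set (borel_state R d1 d2) := Omega1 `*` Omega2.

Definition chi (e r : R) : R := if r <= e then 1 else 0.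

Definition kernel_A (t : R) (x : 'rV[R]_d1) (c : 'rV[R]_d2)
    (y : 'rV[R]_d1) (z : 'rV[R]_d2) : R :=
  chi e1 (N1 (y - x)) * chi e2 (N2 (z - c)) / sigma t x c.

Definition velocity (t : R) (x : 'rV[R]_d1) (c : 'rV[R]_d2) : 'rV[R]_d1 :=
  \row_k \int[f t]_(q in Omega) (kernel_A t x c q.1 q.2 * (q.1 - x) 0 k).

Definition grad_x (phi : state R d1 d2 -> R) (p : state R d1 d2) : 'rV[R]_d1 :=
  \row_k 'D_(delta_mx 0 k, 0) phi p.

(* C^1 on the compact set Omega means C^1 on some open neighbourhood of it.
   Compactness of the support in Omega is then automatic. *)
Definition test_function (phi : state R d1 d2 -> R) : Prop :=
  exists U : set (state R d1 d2),
    [/\ open U, Omega `<=` U,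
        forall p, U p -> differentiable phi p &
        forall v p, U p -> {for p, continuous (fun q => 'D_v phi q)}].

(* Derivative of a function of time t >= 0: two-sided for t > 0 and
   one-sided (from the right) at t = 0. *)
Definition time_derivative (g : R -> R) (t l : R) : Prop :=
  (s - t)^-1 * (g s - g t) @[s --> within [set s | 0 <= s] t^'] --> l.

Definition weak_solution : Prop :=
  (forall t, 0 <= t -> f t Omega = 1%E) /\
  (forall phi, test_function phi -> forall t, 0 <= t ->
     time_derivative
       (fun s => \int[f s]_(p in Omega) phi p) t
       (\int[f t]_(p in Omega)
          \sum_(k < d1) velocity t p.1 p.2 0 k * grad_x phi p 0 k)).

Definition moment1 (k : 'I_d1) (t : R) : R :=
  \int[f t]_(p in Omega) p.1 0 k.

Definition moment2 (k j : 'I_d1) (t : R) : R :=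
  \int[f t]_(p in Omega) (p.1 0 k * p.1 0 j).

End MeanField.

(* Main.v *)
Require Import Defs.
From HB Require Import structures.
From mathcomp Require Import all_boot all_order all_algebra.
From mathcomp Require Import all_classical all_reals all_analysis.
From mathcomp Require Import measurable_realfun lra ring.

Import Order.TTheory GRing.Theory Num.Theory.
Import numFieldNormedType.Exports.

Local Open Scope classical_set_scope.
Local Open Scope ring_scope.

(** Write [A(p,q)] for the interaction kernel between two states [p = (x,c)] and
    [q = (y,z)]. With [sigma = 1] it is symmetric in [p] and [q]. The weak form
    tested against [phi] expresses the derivative of the integral of [phi] as
      [\int\int A(p,q) (y - x) . grad_x phi(p) f(dq) f(dp)],
    and exchanging the names of [p] and [q] shows that this equals
      [- 1/2 \int\int A(p,q) (y - x) . (grad_x phi(q) - grad_x phi(p))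
         f(dq) f(dp)]
    ([velocity_symmetrize]). For [phi = x_k] the difference of gradients
    vanishes, hence the mean is conserved. For [phi = x_k^2] the integrand is
    [2 A(p,q) (y_k - x_k)^2 >= 0], hence the second moment [E_kk] has a
    nonpositive derivative; it is therefore nonincreasing in time
    ([time_derivative_nonincr]), and the bound on [E_kj] follows from
    [2 |x_k x_j| <= x_k^2 + x_j^2] ([moment2_le]).

    The exchange of [p] and [q] is Fubini's theorem for [f(t)] times itself
    ([Rintegral_symmetrize]). Its hypotheses are where the work lies: positions
    are bounded because the domain is compact, and the kernel is measurable for
    the product of the Borel sigma-algebras because a norm is continuous and
    the space is separable ([measurable_norm_sub]). *)

(** * Arbitrary norms on a finite-dimensional space *)

Lemma normr_coord_le {R : realType} {d : nat} (x : 'rV[R]_d) (i : 'I_d) :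
  `|x 0 i| <= `|x|.
Proof.
by rewrite [leRHS]/Num.norm/= mx_normrE; apply/bigmax_geP; right; exists (0, i).
Qed.

Section Norm.
Context {R : realType} {d : nat} {N : 'rV[R]_d -> R}.
Hypothesis hN : is_norm N.

Lemma is_norm0 : N 0 = 0.
Proof. by rewrite -[0 in LHS](scale0r 0) (is_norm_scale hN) normr0 mul0r. Qed.

Lemma is_normN x : N (- x) = N x.
Proof. by rewrite -scaleN1r (is_norm_scale hN) normrN1 mul1r. Qed.

Lemma is_norm_ge0 x : 0 <= N x.
Proof.
have := is_norm_triangle hN x (- x).
by rewrite subrr is_norm0 is_normN -mulr2n pmulrn_lge0.
Qed.

(** Expanding along the standard basis bounds [N] by the sup norm that carries
    the topology; continuity of [N] and the approximation of points by rational
    points in the sense of [N] both come from this bound. *)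
Lemma is_norm_le_sup : exists2 C : R, 0 < C & forall x, N x <= C * `|x|.
Proof.
exists (1 + \sum_i N (delta_mx 0 i)).
  by rewrite ltr_pwDl// sumr_ge0// => i _; exact: is_norm_ge0.
move=> x; rewrite {1}(row_sum_delta x) mulrDl mul1r.
apply: (@le_trans _ _ (\sum_i N (delta_mx 0 i) * `|x|)); last first.
  by rewrite mulr_suml lerDr.
elim/big_ind2: _ => [|a b a' b' ha ha'|i _].
- by rewrite is_norm0.
- by rewrite (le_trans (is_norm_triangle hN _ _))// lerD.
- rewrite (is_norm_scale hN) mulrC ler_wpM2l ?is_norm_ge0//.
  exact: normr_coord_le.
Qed.

Lemma is_norm_continuous : continuous N.
Proof.
have [C C0 NC] := is_norm_le_sup.
move=> x; apply/(@cvgrPdist_lt _ _ _ (nbhs x) (nbhs_filter x)) => e e0.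
have h a b : N a - N b <= C * `|a - b|.
  rewrite (le_trans _ (NC _))// lerBlDr -{1}(subrK b a).
  exact: is_norm_triangle.
apply/nbhs_ballP; exists (e / C); first by rewrite /= divr_gt0.
move=> y; rewrite -ball_normE /= ltr_pdivlMr// mulrC; apply: le_lt_trans.
by rewrite ler_norml h andbT lerNl opprB distrC h.
Qed.

End Norm.

Lemma rat_row_dense {R : realType} {d : nat} (x : 'rV[R]_d) (e : R) : 0 < e ->
  exists q : 'rV[rat]_d, `|x - map_mx ratr q| < e.
Proof.
move=> e0.
have /choice[q qP] : forall i : 'I_d, exists r : rat, `|x 0 i - ratr r| < e.
  move=> i; have [r] : exists r, ratr r \in `]x 0 i - e, x 0 i + e[.
    by apply: rat_in_itvoo; lra.
  by rewrite in_itv/= => /andP[? ?]; exists r; rewrite ltr_norml; lra.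
exists (\row_i q i).
suff : ball x e (map_mx ratr (\row_i q i)) by rewrite -ball_normE.
split=> // i j; rewrite !mxE -ball_normE/= ord1; exact: qP.
Qed.

(** * Borel measurability on the state space *)

Lemma continuous_borel_measurable {R : realType} {d1 d2 : nat}
    (g : state R d1 d2 -> R) :
  continuous g -> measurable_fun [set: borel_state R d1 d2] g.
Proof.
move=> /continuousP cg; apply: (measurability _ (RGenOpens.measurableE R)).
move=> _ [_ [a [b ->] <-]]; rewrite setTI.
by apply: sub_sigma_algebra; apply: cg; exact: interval_open.
Qed.

Lemma closed_borel_measurable {R : realType} {d1 d2 : nat}
    (A : set (state R d1 d2)) :
  closed A -> measurable (A : set (borel_state R d1 d2)).
Proof.
move=> cA; rewrite -[A]setCK; apply: measurableC.
by apply: sub_sigma_algebra; exact: closed_openC.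
Qed.

(** The distance [N (X - Y)] is a function of two points, and an open set of
    pairs need not a priori lie in the product of the Borel sigma-algebras.
    Separability settles this: [N (X - Y) < r] holds exactly when some rational
    [q] satisfies [N (X - q) + N (Y - q) < r], which presents the sublevel set
    as a countable union of sets that are measurable by the hypotheses on each
    of [X] and [Y]. *)
Lemma measurable_norm_sub {R : realType} {d : nat} {N : 'rV[R]_d -> R}
    (hN : is_norm N) {disp : measure_display} {T : measurableType disp}
    (X Y : T -> 'rV[R]_d) :
  (forall a, measurable_fun [set: T] (fun w => N (X w - a))) ->
  (forall a, measurable_fun [set: T] (fun w => N (Y w - a))) ->
  measurable_fun [set: T] (fun w => N (X w - Y w)).
Proof.
move=> mX mY; apply: (measurability _ (RGenInftyO.measurableE R)).
move=> _ [_ [r ->] <-]; rewrite setTI.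
pose near_q (q : 'rV[rat]_d) :=
  [set w | N (X w - map_mx ratr q) + N (Y w - map_mx ratr q) < r].
(* Rational rows are indexed by their codes; a natural number that codes none
   contributes the empty set. *)
rewrite (_ : _ @^-1` _ = \bigcup_n oapp near_q set0 (unpickle n)); last first.
  apply/seteqP; split=> w /=.
    rewrite in_itv/= => XYr; have [C C0 NC] := is_norm_le_sup hN.
    (* By the triangle inequality the sum exceeds N (X - Y) by at most
       2 C |X - q|, hence this accuracy for q. *)
    have /(rat_row_dense (X w))[q xq] : 0 < (r - N (X w - Y w)) / (C + C).
      by apply: divr_gt0; [rewrite subr_gt0|exact: addr_gt0].
    exists (pickle q) => //; rewrite pickleK/= /near_q/=.
    have hX := NC (X w - map_mx ratr q).
    have hY : N (Y w - map_mx ratr q) <=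
        N (X w - Y w) + N (X w - map_mx ratr q).
      rewrite -[N (X w - Y w)](is_normN hN) opprB.
      rewrite (le_trans _ (is_norm_triangle hN _ _))//.
      by rewrite [leRHS](_ : _ = N (Y w - map_mx ratr q))// addrA subrK.
    move: xq; rewrite ltr_pdivlMr ?addr_gt0// mulrC mulrDl; lra.
  move=> [n _]; case: (unpickle n) => //= q; rewrite /near_q/= in_itv/=.
  apply: le_lt_trans; rewrite -[N (Y w - _)](is_normN hN) opprB.
  rewrite (le_trans _ (is_norm_triangle hN _ _))//.
  by rewrite addrA subrK.
apply: bigcupT_measurable => n; case: (unpickle n) => //= q.
rewrite /near_q -[X in measurable X]setTI.
rewrite [X in _ `&` X](_ : _ =
  (fun w => N (X w - map_mx ratr q) + N (Y w - map_mx ratr q)) @^-1`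
    `]-oo, r[%classic); last first.
  by apply/seteqP; split=> w /=; rewrite in_itv.
exact: (measurable_funD (mX _) (mY _)).
Qed.

(** * Symmetrization of iterated integrals *)

(** Fubini for bounded integrands, stated for the real-valued integral: a finite
    measure makes every section and the whole function integrable, so that no
    infinite value is lost when inner integrals are turned into reals. *)
Lemma Rintegral_prod_bounded {R : realType} {disp : measure_display}
    {T : measurableType disp} (P : {finite_measure set T -> \bar R})
    (K : T * T -> R) (M : R) :
  measurable_fun setT K -> (forall w, `|K w| <= M) ->
  [/\ (P \x P)%E.-integrable setT (EFin \o K),
      \int[(P \x P)%E]_w K w = \int[P]_p \int[P]_q K (p, q) &
      \int[(P \x P)%E]_w K w = \int[P]_q \int[P]_p K (p, q)].
Proof.
move=> mK KM.
have bnd S (g : S -> R) : (forall s, `|g s| <= M) -> [bounded g s | s in setT].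
  move=> gM; exists M; split=> [|y My s _]; first exact: num_real.
  exact: le_trans (gM s) (ltW My).
have fin1 : (P setT < +oo)%E by rewrite -ge0_fin_numE//; exact: fin_num_measure.
have fin2 : ((P \x P)%E setT < +oo)%E.
  rewrite -setXTT product_measure1E//.
  by apply: lte_mul_pinfty => //; exact: fin_num_measure.
have intK : (P \x P)%E.-integrable setT (EFin \o K).
  by apply: measurable_bounded_integrable => //; exact: bnd.
have intK1 p : P.-integrable setT (EFin \o fun q => K (p, q)).
  apply: measurable_bounded_integrable => //; [|exact: bnd].
  exact: measurable_fun_pair2.
have intK2 q : P.-integrable setT (EFin \o fun p => K (p, q)).
  apply: measurable_bounded_integrable => //; [|exact: bnd].
  exact: measurable_fun_pair1.
split => //.
- rewrite /Rintegral -(integral12_prod_meas1 intK).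
  congr fine; apply: eq_integral => p _; rewrite fineK//.
  exact: (integrable_fin_num _ (intK1 p)).
- rewrite /Rintegral -(integral21_prod_meas1 intK).
  congr fine; apply: eq_integral => q _; rewrite fineK//.
  exact: (integrable_fin_num _ (intK2 q)).
Qed.

Lemma Rintegral_le0 {R : realType} {disp : measure_display}
    {T : measurableType disp} (P : {measure set T -> \bar R}) (D : set T)
    (g : T -> R) :
  (forall x, D x -> g x <= 0) -> \int[P]_(x in D) g x <= 0.
Proof.
move=> g0; apply: fine_le0.
have Ng0 x : D x -> (0 <= (- g x)%:E)%E.
  by move=> Dx; rewrite lee_fin oppr_ge0 g0.
under eq_integral do rewrite -[g _]opprK EFinN.
by rewrite integral_ge0N// oppe_le0; exact: integral_ge0.
Qed.

Lemma Rintegral_eq0 {R : realType} {disp : measure_display}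
    {T : measurableType disp} (P : {measure set T -> \bar R}) (D : set T)
    (g : T -> R) :
  (forall x, D x -> g x = 0) -> \int[P]_(x in D) g x = 0.
Proof.
move=> g0; apply/eqP.
by rewrite eq_le Rintegral_le0 ?Rintegral_ge0// => x /g0 ->.
Qed.

(** Truncating the integrand to [D `*` D] gives a function that is bounded on
    the whole product even when [G] is bounded only over [D]. *)
Lemma Rintegral_iter_restrict {R : realType} {disp : measure_display}
    {T : measurableType disp} (P : {measure set T -> \bar R}) (D : set T)
    (G : T -> T -> R) :
  \int[P]_(p in D) \int[P]_(q in D) G p q =
  \int[P]_p \int[P]_q (\1_D p * \1_D q * G p q).
Proof.
rewrite Rintegral_mkcond; apply: eq_Rintegral => p _; rewrite patchE.
case: ifPn => pD.
  rewrite Rintegral_mkcond; apply: eq_Rintegral => q _.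
  by rewrite patchE !indicE pD mul1r; case: ifPn => qD; rewrite ?mul1r ?mul0r.
rewrite (_ : (fun q => _) = cst 0) ?Rintegral_cst ?mul0r//.
by apply/funext => q; rewrite !indicE (negbTE pD) !mul0r.
Qed.

(** Exchanging the order of integration amounts to exchanging the two arguments
    of [G], so an iterated integral over a square only sees the symmetric part
    of [G]. *)
Lemma Rintegral_symmetrize {R : realType} {disp : measure_display}
    {T : measurableType disp} (P : {finite_measure set T -> \bar R})
    (D : set T) (G : T -> T -> R) (M : R) :
  measurable D -> measurable_fun setT (fun w : T * T => G w.1 w.2) ->
  (forall p q, D p -> D q -> `|G p q| <= M) ->
  \int[P]_(p in D) \int[P]_(q in D) G p q =
  2^-1 * \int[P]_(p in D) \int[P]_(q in D) (G p q + G q p).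
Proof.
move=> mD mG GM.
pose H (w : T * T) : R := \1_D w.1 * \1_D w.2 * G w.1 w.2.
pose Hs (w : T * T) := H (w.2, w.1).
have mH : measurable_fun setT H.
  apply: measurable_funM => //; apply: measurable_funM.
    exact: (measurableT_comp (measurable_indic mD) measurable_fst).
  exact: (measurableT_comp (measurable_indic mD) measurable_snd).
have mHs : measurable_fun setT Hs.
  apply: (measurableT_comp mH); exact: measurable_swap.
have HM w : `|H w| <= `|M|.
  rewrite /H !indicE; have [/set_mem w1|_] := boolP (w.1 \in D);
    have [/set_mem w2|_] := boolP (w.2 \in D);
    rewrite ?mul0r ?mulr0 ?mul0r ?normr0// !mul1r.
  by rewrite (le_trans (GM _ _ w1 w2))// ler_norm.
have HsM w : `|Hs w| <= `|M| by exact: HM.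
have HHsM w : `|H w + Hs w| <= `|M| + `|M|.
  by rewrite (le_trans (ler_normD _ _))// lerD.
have [intH H12 H21] := Rintegral_prod_bounded P H `|M| mH HM.
have [intHs Hs12 _] := Rintegral_prod_bounded P Hs `|M| mHs HsM.
have [_ HHs12 _] := Rintegral_prod_bounded P (fun w => H w + Hs w) _
  (measurable_funD mH mHs) HHsM.
rewrite [LHS]Rintegral_iter_restrict [in RHS]Rintegral_iter_restrict.
transitivity (2^-1 * \int[(P \x P)%E]_w (H w + Hs w)); last first.
  rewrite HHs12; congr (_ * _); apply: eq_Rintegral => p _.
  by apply: eq_Rintegral => q _; rewrite /Hs /H/= mulrDr [\1_D q * _]mulrC.
have HsH : \int[(P \x P)%E]_w Hs w = \int[(P \x P)%E]_w H w.
  by rewrite Hs12 H21.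
rewrite RintegralD// HsH -H12; move: (Rintegral _ _ _) => I; lra.
Qed.

(** * Monotonicity from the sign of the time derivative *)

(** Away from the origin a time derivative is an ordinary derivative, and at
    every point, the origin included, bounded difference quotients give
    continuity within the half-line; the mean value theorem then applies. *)
Lemma time_derivative_nonincr {R : realType} (g : R -> R) :
  (forall t : R, 0 <= t -> exists2 l : R, time_derivative g t l & l <= 0) ->
  forall s t : R, 0 <= s -> s <= t -> g t <= g s.
Proof.
move=> dg.
have drv (t : R) : 0 < t -> exists2 l : R, l <= 0 & is_derive t 1 g l.
  move=> t0; have [l gl l0] := dg t (ltW t0); exists l => //.
  suff H : h^-1 *: (g (h *: 1 + t) - g t) @[h --> 0^'] --> l.
    by apply: DeriveDef; [apply/cvg_ex; exists l|exact: cvg_lim H].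
  apply/cvgrPdist_lt => e e0; move/cvgrPdist_lt: gl => /(_ _ e0).
  rewrite !near_withinE => /nbhs_ballP[r /= r0 rP].
  (* The radius t keeps t + h nonnegative, where difference quotients are
     controlled. *)
  apply/nbhs_ballP; exists (Num.min r t); first by rewrite /= lt_min r0.
  move=> h; rewrite /ball/= sub0r normrN lt_min => /andP[hr ht] h0.
  rewrite scaler1; have := rP (h + t).
  rewrite /ball/= opprD addrCA subrr addr0 normrN addrK.
  apply => //; first by rewrite -subr_eq0 addrK.
  by move: ht; rewrite ltr_norml/=; lra.
apply: ler0_derive1_nincry => [x|x|].
- by rewrite in_itv/= andbT => /drv[l _ []].
- by rewrite in_itv/= andbT => /drv[l l0 gl]; rewrite derive1E derive_val.
- apply/subspace_continuousP => x /=; rewrite in_itv/= andbT => x0.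
  have [l gl _] := dg x x0.
  apply/cvgrPdist_lt => e e0; move/cvgrPdist_lt: gl => /(_ _ ltr01).
  rewrite !near_withinE => /nbhs_ballP[r /= r0 rP].
  have L0 : 0 < `|l| + 1 by rewrite ltr_wpDl.
  apply/nbhs_ballP; exists (Num.min r (e / (`|l| + 1))).
    by rewrite /= lt_min r0 divr_gt0.
  move=> y; rewrite /ball/= lt_min ltr_pdivlMr// => /andP[yr ye].
  rewrite in_itv/= andbT => y0.
  have [->|yx] := eqVneq y x; first by rewrite subrr normr0.
  have := rP y yr yx y0; set q := _ * _ => ql.
  have -> : g x - g y = (x - y) * q.
    rewrite /q; field; by rewrite subr_eq0.
  rewrite normrM (le_lt_trans _ ye)// ler_wpM2l//.
  rewrite -[q](subrK l) (le_trans (ler_normD _ _))// addrC lerD2l ltW//.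
  by rewrite distrC.
Qed.

(** * Coordinates as test functions *)

Section Coordinates.
Context {R : realType} {d1 d2 : nat}.
Implicit Types (p v : state R d1 d2) (k i : 'I_d1).

Lemma coord_x_continuous k : continuous (fun p => p.1 0 k).
Proof.
move=> p; apply: (@continuous_comp _ _ _ fst (fun x : 'rV[R]_d1 => x 0 k)).
  exact: cvg_fst.
exact: coord_continuous.
Qed.

Lemma is_diff_coord_x k p : is_diff p (fun q => q.1 0 k) (fun v => v.1 0 k).
Proof.
have @f : {linear state R d1 d2 -> R}.
  by exists (fun p => p.1 0 k); do 2![eexists]; do ?[constructor];
    rewrite ?mxE// => ? *; rewrite ?mxE//; move=> ?; rewrite !mxE.
rewrite (_ : (fun _ => _) = f)//.
have cf : continuous f by exact: coord_x_continuous.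
by apply: DiffDef; [exact: linear_differentiable|exact: diff_lin].
Qed.

Lemma is_diff_coord_x_sq k p :
  is_diff p (fun q => q.1 0 k * q.1 0 k) (fun v => 2 * p.1 0 k * v.1 0 k).
Proof.
have dk := is_diff_coord_x k p; apply: is_diff_eq (is_diffM dk dk) _.
apply/funext => v.
by change (p.1 0 k * v.1 0 k + p.1 0 k * v.1 0 k = 2 * p.1 0 k * v.1 0 k); ring.
Qed.

Lemma derive_is_diff (phi : state R d1 d2 -> R) dphi p v :
  is_diff p phi dphi -> 'D_v phi p = dphi v.
Proof. by move=> [dphip <-]; rewrite deriveE. Qed.

Lemma test_function_of_is_diff (Omega1 : set 'rV[R]_d1) (Omega2 : set 'rV[R]_d2)
    (phi : state R d1 d2 -> R) (dphi : state R d1 d2 -> state R d1 d2 -> R) :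
  (forall p, is_diff p phi (dphi p)) ->
  (forall v, continuous (fun p => dphi p v)) ->
  test_function Omega1 Omega2 phi.
Proof.
move=> Dphi Cphi; exists setT; split => //; first exact: openT.
move=> v p _; rewrite (_ : (fun q => _) = fun q => dphi q v); first exact: Cphi.
by apply/funext => q; exact: derive_is_diff.
Qed.

Lemma test_function_coord_x Omega1 Omega2 k :
  test_function Omega1 Omega2 (fun p => p.1 0 k).
Proof.
apply: (test_function_of_is_diff _ _ _ (fun _ v => v.1 0 k)) => [p|v].
  exact: is_diff_coord_x.
by move=> p; exact: cvg_cst.
Qed.

Lemma test_function_coord_x_sq Omega1 Omega2 k :
  test_function Omega1 Omega2 (fun p => p.1 0 k * p.1 0 k).
Proof.
apply: (test_function_of_is_diff _ _ _
  (fun p v => 2 * p.1 0 k * v.1 0 k)) => [p|v].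
  exact: is_diff_coord_x_sq.
move=> p; apply: cvgM; last exact: cvg_cst.
by apply: cvgM; [exact: cvg_cst|exact: coord_x_continuous].
Qed.

(** A test function whose differential is a multiple of [x_k] only detects the
    [k]-th component of the velocity. *)
Lemma sum_grad_coord (V : 'rV[R]_d1) k (phi : state R d1 d2 -> R) p (a : R) :
  is_diff p phi (fun v => a * v.1 0 k) ->
  \sum_(i < d1) V 0 i * grad_x phi p 0 i = a * V 0 k.
Proof.
move=> Dphi; rewrite (bigD1 k)//= big1 => [|i ik];
  rewrite !mxE (derive_is_diff _ _ _ _ Dphi)/= mxE eqxx.
  by rewrite eqxx addr0 mulr1 mulrC.
by rewrite eq_sym (negbTE ik) !mulr0.
Qed.

End Coordinates.

(** * The kernel and the velocity *)

Section Kernel.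
Context {R : realType} {d1 d2 : nat}.
Context {N1 : 'rV[R]_d1 -> R} {N2 : 'rV[R]_d2 -> R}.
Hypotheses (hN1 : is_norm N1) (hN2 : is_norm N2).
Variables (e1 e2 : R) (sigma : R -> 'rV[R]_d1 -> 'rV[R]_d2 -> R).
Hypothesis hsigma : forall t x c, sigma t x c = 1.
Let B : measurableType _ := borel_state R d1 d2.

Lemma chi_bounds (e r : R) : 0 <= chi e r <= 1.
Proof. by rewrite /chi; case: ifP; rewrite ?lexx ?ler01. Qed.

Lemma kernel_A_unit t x c y z :
  kernel_A N1 N2 e1 e2 sigma t x c y z =
  chi e1 (N1 (y - x)) * chi e2 (N2 (z - c)).
Proof. by rewrite /kernel_A hsigma divr1. Qed.

Lemma kernel_A_sym t x c y z :
  kernel_A N1 N2 e1 e2 sigma t x c y z = kernel_A N1 N2 e1 e2 sigma t y z x c.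
Proof.
by rewrite !kernel_A_unit -(is_normN hN1) -(is_normN hN2 (z - c)) !opprB.
Qed.

Lemma kernel_A_bounds t x c y z :
  0 <= kernel_A N1 N2 e1 e2 sigma t x c y z <= 1.
Proof.
rewrite kernel_A_unit.
have /andP[a0 a1] := chi_bounds e1 (N1 (y - x)).
have /andP[b0 b1] := chi_bounds e2 (N2 (z - c)).
by rewrite mulr_ge0//= mulr_ile1.
Qed.

Lemma measurable_chi {disp : measure_display} {T : measurableType disp}
    (e : R) (g : T -> R) :
  measurable_fun setT g -> measurable_fun setT (fun w => chi e (g w)).
Proof.
move=> mg; apply: measurable_fun_ifT => //; exact: measurable_fun_ler.
Qed.

Lemma measurable_kernel_A t : measurable_fun [set: B * B] (fun w =>
  kernel_A N1 N2 e1 e2 sigma t w.1.1 w.1.2 w.2.1 w.2.2).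
Proof.
under eq_fun do rewrite kernel_A_unit.
have m1 a : measurable_fun [set: B] (fun p : B => N1 (p.1 - a)).
  apply: continuous_borel_measurable => p.
  apply: (@continuous_comp _ _ _ (fun p : state R d1 d2 => p.1 - a) N1).
    by apply: cvgB; [exact: cvg_fst|exact: cvg_cst].
  exact: is_norm_continuous hN1 _.
have m2 a : measurable_fun [set: B] (fun p : B => N2 (p.2 - a)).
  apply: continuous_borel_measurable => p.
  apply: (@continuous_comp _ _ _ (fun p : state R d1 d2 => p.2 - a) N2).
    by apply: cvgB; [exact: cvg_snd|exact: cvg_cst].
  exact: is_norm_continuous hN2 _.
apply: measurable_funM; apply: measurable_chi.
- apply: (measurable_norm_sub hN1
    (fun w : B * B => w.2.1) (fun w => w.1.1)) => a.
    exact: (measurableT_comp (m1 a) measurable_snd).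
  exact: (measurableT_comp (m1 a) measurable_fst).
- apply: (measurable_norm_sub hN2
    (fun w : B * B => w.2.2) (fun w => w.1.2)) => a.
    exact: (measurableT_comp (m2 a) measurable_snd).
  exact: (measurableT_comp (m2 a) measurable_fst).
Qed.

Context (Omega1 : set 'rV[R]_d1) (Omega2 : set 'rV[R]_d2).
Hypotheses (hOmega1 : compact Omega1) (hOmega2 : compact Omega2).
Variable f : R -> probability (borel_state R d1 d2) R.
Let Omega : set B := Omega1 `*` Omega2.

Lemma measurable_Omega : measurable Omega.
Proof.
apply: closed_borel_measurable; apply: compact_closed.
  exact: norm_hausdorff.
exact: compact_setX.
Qed.

Lemma coord_x_bounded (k : 'I_d1) :
  exists M : R, forall p, Omega p -> `|p.1 0 k| <= M.
Proof.
have [M [_ hM]] := compact_bounded hOmega1.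
exists (M + 1) => p [/= p1 _].
rewrite (le_trans (normr_coord_le _ _))//; apply: (hM _ _ _ p1).
by rewrite ltrDl.
Qed.

(** Testing the velocity against [a] gives the double integral of
    [A(p,q) a(p) (y_k - x_k)], where [p] has position [x] and [q] has position
    [y]. The kernel is symmetric and [y_k - x_k] antisymmetric, so
    symmetrization replaces [a(p)] by a difference of values of [a]: constant
    [a] gives zero, and [a] nondecreasing in the coordinate [x_k] gives a
    nonpositive number. *)
Lemma velocity_symmetrize (k : 'I_d1) (t : R) (a : state R d1 d2 -> R) :
  continuous a -> (exists A, forall p, Omega p -> `|a p| <= A) ->
  \int[f t]_(p in Omega)
    (a p * velocity N1 N2 Omega1 Omega2 e1 e2 sigma f t p.1 p.2 0 k) =
  2^-1 * \int[f t]_(p in Omega) \int[f t]_(q in Omega)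
    (kernel_A N1 N2 e1 e2 sigma t p.1 p.2 q.1 q.2
     * ((a q - a p) * (p.1 0 k - q.1 0 k))).
Proof.
move=> ca [A hA]; have [M hM] := coord_x_bounded k.
pose v (p q : B) : R :=
  kernel_A N1 N2 e1 e2 sigma t p.1 p.2 q.1 q.2 * (q.1 0 k - p.1 0 k).
have mx : measurable_fun [set: B] (fun p : B => p.1 0 k).
  exact: continuous_borel_measurable (coord_x_continuous k).
have mv : measurable_fun [set: B * B] (fun w => v w.1 w.2).
  apply: measurable_funM; first exact: measurable_kernel_A.
  apply: measurable_funB; first exact: (measurableT_comp mx measurable_snd).
  exact: (measurableT_comp mx measurable_fst).
have hv p q : Omega p -> Omega q -> `|v p q| <= M + M.
  move=> Op Oq; rewrite /v normrM.
  have /andP[k0 k1] := kernel_A_bounds t p.1 p.2 q.1 q.2.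
  rewrite (ger0_norm k0) -[leRHS]mul1r ler_pM//.
  by rewrite (le_trans (ler_normB _ _))// lerD// hM.
have intv p : Omega p -> (f t).-integrable Omega (EFin \o v p).
  move=> Op; apply: measurable_bounded_integrable.
  - exact: measurable_Omega.
  - by rewrite -ge0_fin_numE//; exact: fin_num_measure measurable_Omega.
  - apply: measurable_funTS.
    exact: (@measurable_fun_pair2 _ _ _ _ _ _ (fun w => v w.1 w.2)).
  - exists (M + M); split=> [|y My q Oq]; first exact: num_real.
    exact: le_trans (hv _ _ Op Oq) (ltW My).
transitivity (\int[f t]_(p in Omega) \int[f t]_(q in Omega) (a p * v p q)).
  apply: eq_Rintegral => p /set_mem Op; rewrite RintegralZl//.
  - rewrite mxE; congr (_ * _); apply: eq_Rintegral => q _.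
    by rewrite /v !mxE.
  - exact: measurable_Omega.
  - exact: intv.
have ma : measurable_fun [set: B] (a : B -> R).
  exact: continuous_borel_measurable.
rewrite (@Rintegral_symmetrize _ _ _ _ _ _ (A * (M + M))).
- congr (_ * _); apply: eq_Rintegral => p _; apply: eq_Rintegral => q _.
  by rewrite /v (kernel_A_sym t q.1); ring.
- exact: measurable_Omega.
- apply: measurable_funM mv; exact: (measurableT_comp ma measurable_fst).
- by move=> p q Op Oq; rewrite normrM ler_pM// ?hA// hv.
Qed.

End Kernel.

(** * First and second moments *)

Section Moments.
Context {R : realType} {d1 d2 : nat}.
Context {N1 : 'rV[R]_d1 -> R} {N2 : 'rV[R]_d2 -> R}.
Hypotheses (hN1 : is_norm N1) (hN2 : is_norm N2).
Context {Omega1 : set 'rV[R]_d1} {Omega2 : set 'rV[R]_d2}.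
Hypotheses (hOmega1 : compact Omega1) (hOmega2 : compact Omega2).
Context {e1 e2 : R} {sigma : R -> 'rV[R]_d1 -> 'rV[R]_d2 -> R}.
Hypothesis hsigma : forall t x c, sigma t x c = 1.
Context {f : R -> probability (borel_state R d1 d2) R}.
Hypothesis hf : weak_solution N1 N2 Omega1 Omega2 e1 e2 sigma f.
Let Omega : set (borel_state R d1 d2) := Omega1 `*` Omega2.
Implicit Types (k j : 'I_d1) (t : R).

Lemma time_derivative_moment1 k t : 0 <= t ->
  time_derivative (moment1 Omega1 Omega2 f k) t 0.
Proof.
move=> t0; have := hf.2 _ (test_function_coord_x Omega1 Omega2 k) t t0.
set l := Rintegral _ _ _; suff -> : l = 0 by [].
transitivity (\int[f t]_(p in Omega)
    (1 * velocity N1 N2 Omega1 Omega2 e1 e2 sigma f t p.1 p.2 0 k)).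
  apply: eq_Rintegral => p _; apply: sum_grad_coord.
  apply: is_diff_eq (is_diff_coord_x k p) _.
  by apply/funext => v; rewrite mul1r.
rewrite (velocity_symmetrize hN1 hN2 _ _ _ hsigma _ _ hOmega1 hOmega2 f k t
  (fun=> 1)).
- rewrite Rintegral_eq0 ?mulr0// => p _; apply: Rintegral_eq0 => q _.
  by rewrite subrr mul0r mulr0.
- by move=> p; exact: cvg_cst.
- by exists 1 => p _; rewrite normr1.
Qed.

Lemma time_derivative_moment2 k t : 0 <= t ->
  exists2 l : R, time_derivative (moment2 Omega1 Omega2 f k k) t l & l <= 0.
Proof.
move=> t0; have := hf.2 _ (test_function_coord_x_sq Omega1 Omega2 k) t t0.
set l := Rintegral _ _ _; exists l => //.
have -> : l = \int[f t]_(p in Omega) (2 * p.1 0 k *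
    velocity N1 N2 Omega1 Omega2 e1 e2 sigma f t p.1 p.2 0 k).
  apply: eq_Rintegral => p _; apply: sum_grad_coord; exact: is_diff_coord_x_sq.
rewrite (velocity_symmetrize hN1 hN2 _ _ _ hsigma _ _ hOmega1 hOmega2 f k t
  (fun p => 2 * p.1 0 k)).
- rewrite pmulr_rle0 ?invr_gt0//; apply: Rintegral_le0 => p _.
  apply: Rintegral_le0 => q _; apply: mulr_ge0_le0.
    by have /andP[] := @kernel_A_bounds _ _ _ N1 N2 e1 e2 sigma hsigma
      t p.1 p.2 q.1 q.2.
  have -> : (2 * q.1 0 k - 2 * p.1 0 k) * (p.1 0 k - q.1 0 k) =
      - (2 * (p.1 0 k - q.1 0 k) ^+ 2) by ring.
  by rewrite oppr_le0 mulr_ge0// sqr_ge0.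
- by move=> p; apply: cvgM; [exact: cvg_cst|exact: coord_x_continuous].
- have [M hM] := coord_x_bounded Omega1 Omega2 hOmega1 k.
  by exists (2 * M) => p Op; rewrite normrM ger0_norm// ler_wpM2l// hM.
Qed.

Lemma coord_x_mul_integrable k j t :
  (f t).-integrable Omega
    (EFin \o fun p : state R d1 d2 => p.1 0 k * p.1 0 j).
Proof.
have [M hM] := coord_x_bounded Omega1 Omega2 hOmega1 k.
have [M' hM'] := coord_x_bounded Omega1 Omega2 hOmega1 j.
have mO := measurable_Omega _ _ hOmega1 hOmega2.
apply: measurable_bounded_integrable => //.
- by rewrite -ge0_fin_numE//; exact: fin_num_measure mO.
- apply: measurable_funTS; apply: measurable_funM;
    exact: continuous_borel_measurable (coord_x_continuous _).
- exists (M * M'); split=> [|y My p Op]; first exact: num_real.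
  by rewrite /= normrM (le_trans _ (ltW My))// ler_pM// ?hM ?hM'.
Qed.

(** Pointwise [2 |x_k x_j| <= x_k^2 + x_j^2], then integrate. *)
Lemma moment2_le k j t :
  `|moment2 Omega1 Omega2 f k j t| <=
  2^-1 * (moment2 Omega1 Omega2 f k k t + moment2 Omega1 Omega2 f j j t).
Proof.
have mO := measurable_Omega _ _ hOmega1 hOmega2.
have int2 k' j' := coord_x_mul_integrable k' j' t.
rewrite /moment2 -RintegralD// -RintegralZl//; last first.
  exact: integrableD (int2 k k) (int2 j j).
apply: le_trans (le_normr_Rintegral _ (int2 k j)) _ => //.
apply: le_Rintegral => //.
- exact: integrable_norm.
- exact: integrableZl (integrableD mO (int2 k k) (int2 j j)).
- move=> p _; set x := p.1 0 k; set y := p.1 0 j.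
  rewrite normrM; have := sqr_ge0 (`|x| - `|y|).
  by rewrite sqrrB !real_normK ?num_real// !expr2; lra.
Qed.

End Moments.

Theorem lemma3p1 (R : realType) (d1 d2 : nat)
    (N1 : 'rV[R]_d1 -> R) (N2 : 'rV[R]_d2 -> R)
    (Omega1 : set 'rV[R]_d1) (Omega2 : set 'rV[R]_d2)
    (e1 e2 : R) (sigma : R -> 'rV[R]_d1 -> 'rV[R]_d2 -> R)
    (f : R -> probability (borel_state R d1 d2) R)
    (hN1 : is_norm N1) (hN2 : is_norm N2)
    (hOmega1 : compact Omega1) (hOmega2 : compact Omega2)
    (he1 : 0 <= e1) (he2 : 0 <= e2)
    (hsigma : forall t x c, sigma t x c = 1)
    (hf : weak_solution N1 N2 Omega1 Omega2 e1 e2 sigma f) :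
  forall (k j : 'I_d1) (t : R), 0 <= t ->
    [/\ time_derivative (moment1 Omega1 Omega2 f k) t 0,
        exists2 l : R,
          time_derivative (moment2 Omega1 Omega2 f k k) t l & l <= 0 &
        `|moment2 Omega1 Omega2 f k j t| <=
          2^-1 * (moment2 Omega1 Omega2 f k k 0
                  + moment2 Omega1 Omega2 f j j 0)].
Proof.
move=> k j t t0.
have dE := time_derivative_moment2 hN1 hN2 hOmega1 hOmega2 hsigma hf.
split.
- exact (time_derivative_moment1 hN1 hN2 hOmega1 hOmega2 hsigma hf k t t0).
- exact: dE.
- apply: le_trans (moment2_le hOmega1 hOmega2 k j t) _.
  rewrite ler_wpM2l ?invr_ge0// lerD//;
    exact: time_derivative_nonincr (dE _) _ _ (lexx 0) t0.
Qed.
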